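(* Let $I\subset\mathbb R$ be an interval, let $h\in C^\infty(I)$, and consider the family of lines $L_t:\ y=tx+h(t)$, $t\in I$. Let $\Psi(u,v)$, $u\neq v$, be the intersection point of $L_u$ and $L_v$, let $J_\Psi$ be its Jacobian determinant, and set $S_h(u,v):=\partial_u\partial_v\log|J_\Psi(u,v)|$. Let $t_0\in I$ satisfy $h''(t_0)\neq0$, and let $R_h$ be the smooth extension across the diagonal, near $(t_0,t_0)$, of the function $S_h(u,v)-\frac{1}{(v-u)^2}$. Let $\gamma(t)=\bigl(-h'(t),\,h(t)-t\,h'(t)\bigr)$ be the envelope of the family and let $\sigma$ be its equi-affine arclength parameter, so that $d\sigma=|h''(t)|^{2/3}\,dt$. Then, for $t$ near $t_0$, $$R_h(t,t)=\frac12\{\sigma,t\},$$ where $\{\sigma,t\}$ is the Schwarzian derivative of $\sigma$ with respect to $t$. Equivalently, $$R_h(t,t)=-\kappa_{\mathrm{aff}}(\sigma)\left(\frac{d\sigma}{dt}\right)^2,$$ where $\kappa_{\mathrm{aff}}$ is the equi-affine curvature of the envelope, with the convention $\gamma_{\sigma\sigma\sigma}+\kappa_{\mathrm{aff}}\gamma_\sigma=0$.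
   Context: For $u\neq v$ in $I$, the intersection point of $L_u$ and $L_v$ is $$\Psi(u,v)=(x(u,v),y(u,v))=\left(\frac{h(v)-h(u)}{u-v},\ \frac{u\,h(v)-v\,h(u)}{u-v}\right),$$ and $J_\Psi=x_uy_v-x_vy_u$. When $h''(t_0)\ne0$, $S_h$ is defined off the diagonal near $(t_0,t_0)$, and the function $S_h(u,v)-1/(v-u)^2$ extends to a smooth function $R_h$ on a full neighborhood of $(t_0,t_0)$ in $I\times I$, including the diagonal. Schwarzian derivative: for a local diffeomorphism $f=f(t)$ of the line, $\{f,t\}=\left(\frac{f''}{f'}\right)'-\frac12\left(\frac{f''}{f'}\right)^2=\frac{f'''}{f'}-\frac32\left(\frac{f''}{f'}\right)^2$. Equi-affine arclength: $d\sigma=|\det(\gamma_t,\gamma_{tt})|^{1/3}dt$, on an interval around $t_0$ where $h''\neq0$; for the envelope, $\det(\gamma_t,\gamma_{tt})=h''(t)^2$. Thus $\sigma(t)$ is an antiderivative of $|h''(t)|^{2/3}$, determined up to an additive constant, and $t$ may locally be regarded as a function of $\sigma$. Equi-affine curvature: when $\gamma$ is reparametrized by $\sigma$ one has $\det(\gamma_\sigma,\gamma_{\sigma\sigma})=1$, so $\gamma_{\sigma\sigma\sigma}$ is a scalar multiple of $\gamma_\sigma$, and $\kappa_{\mathrm{aff}}(\sigma)$ is the function defined by $\gamma_{\sigma\sigma\sigma}+\kappa_{\mathrm{aff}}(\sigma)\gamma_\sigma=0$. *)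

(* Defs.v *)
From Stdlib Require Import Reals Lra.
From Coquelicot Require Import Coquelicot.
Open Scope R_scope.

(** A singleton is excluded: derivatives relative to it are meaningless. *)
Definition is_interval (I : R -> Prop) : Prop :=
  (forall a b x, I a -> I b -> a <= x <= b -> I x) /\
  (exists a b, I a /\ I b /\ a < b).

(** The interval may contain its endpoints, where derivatives are one-sided.
    [is_derive_on D] is Coquelicot's [is_derive] with the filter [locally x]
    replaced by its trace on [D]; the two agree at interior points of [D]
    ([is_derive_on_interior]).  As with [Derive], [Derive_on] is a total
    operator, meaningful only where the derivative exists and is unique. *)
Definition is_derive_on (D : R -> Prop) (f : R -> R) (x l : R) : Prop :=
  filterdiff f (within D (locally x)) (fun y => scal y l).

Definition ex_derive_on (D : R -> Prop) (f : R -> R) (x : R) : Prop :=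
  exists l, is_derive_on D f x l.

Definition Derive_on (D : R -> Prop) (f : R -> R) (x : R) : R :=
  iota (fun l => is_derive_on D f x l).

Fixpoint Derive_n_on (D : R -> Prop) (f : R -> R) (n : nat) (x : R) : R :=
  match n with
  | O => f x
  | S n => Derive_on D (Derive_n_on D f n) x
  end.

Definition smooth_on (D : R -> Prop) (f : R -> R) : Prop :=
  forall n x, D x -> ex_derive_on D (Derive_n_on D f n) x.

Definition D1 (D : R -> Prop) (f : R -> R -> R) (u v : R) : R :=
  Derive_on D (fun u' => f u' v) u.

Definition D2 (D : R -> Prop) (f : R -> R -> R) (u v : R) : R :=
  Derive_on D (fun v' => f u v') v.

Definition square (D : R -> Prop) (p : R * R) : Prop := D (fst p) /\ D (snd p).

Fixpoint Cn_on_square (D : R -> Prop) (n : nat) (f : R -> R -> R) : Prop :=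
  continuous_on (square D) (fun p => f (fst p) (snd p)) /\
  match n with
  | O => True
  | S n =>
      (forall u v, D u -> D v ->
        ex_derive_on D (fun u' => f u' v) u /\
        ex_derive_on D (fun v' => f u v') v) /\
      Cn_on_square D n (D1 D f) /\
      Cn_on_square D n (D2 D f)
  end.

Definition smooth_on_square (D : R -> Prop) (f : R -> R -> R) : Prop :=
  forall n, Cn_on_square D n f.

Definition near (I : R -> Prop) (t0 r : R) (t : R) : Prop :=
  I t /\ Rabs (t - t0) < r.

Definition line (h : R -> R) (t : R) (p : R * R) : Prop :=
  snd p = t * fst p + h t.

Definition Psi_x (h : R -> R) (u v : R) : R := (h v - h u) / (u - v).

Definition Psi_y (h : R -> R) (u v : R) : R := (u * h v - v * h u) / (u - v).

Definition J_Psi (I : R -> Prop) (h : R -> R) (u v : R) : R :=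
  D1 I (Psi_x h) u v * D2 I (Psi_y h) u v
  - D2 I (Psi_x h) u v * D1 I (Psi_y h) u v.

Definition S_h (I : R -> Prop) (h : R -> R) : R -> R -> R :=
  D1 I (D2 I (fun u v => ln (Rabs (J_Psi I h u v)))).

(** [Rh] is only constrained on [near I t0 r] squared for some [r > 0]; any
    neighborhood of [(t0, t0)] in [I * I] contains such a square. *)
Definition is_smooth_extension
    (I : R -> Prop) (h : R -> R) (t0 : R) (Rh : R -> R -> R) : Prop :=
  exists r, 0 < r /\
    smooth_on_square (near I t0 r) Rh /\
    (forall u v, near I t0 r u -> near I t0 r v -> u <> v ->
      Rh u v = S_h I h u v - 1 / (v - u) ^ 2).

Definition envelope (I : R -> Prop) (h : R -> R) (t : R) : R * R :=
  (- Derive_on I h t, h t - t * Derive_on I h t).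

Definition curve_derive_n
    (D : R -> Prop) (c : R -> R * R) (n : nat) (t : R) : R * R :=
  (Derive_n_on D (fun s => fst (c s)) n t,
   Derive_n_on D (fun s => snd (c s)) n t).

Definition det2 (a b : R * R) : R := fst a * snd b - snd a * fst b.

(** [Rpower 0 (1 / 3)] is [1] rather than [0], so this is the intended notion
    only when the determinant does not vanish on [D]. *)
Definition is_affine_arclength
    (D : R -> Prop) (c : R -> R * R) (sigma : R -> R) : Prop :=
  forall t, D t ->
    is_derive_on D sigma t
      (Rpower (Rabs (det2 (curve_derive_n D c 1 t) (curve_derive_n D c 2 t)))
        (1 / 3)).

(** The scalar [k] such that [c''' + k c' = 0] at [s]; here [c] is expected to
    be parametrized by equi-affine arclength. *)
Definition affine_curvature
    (D : R -> Prop) (c : R -> R * R) (s : R) : R :=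
  iota (fun k : R =>
    plus (curve_derive_n D c 3 s) (scal k (curve_derive_n D c 1 s)) = zero).

Definition image (f : R -> R) (D : R -> Prop) (s : R) : Prop :=
  exists t, D t /\ f t = s.

Definition schwarzian (D : R -> Prop) (f : R -> R) (t : R) : R :=
  Derive_on D (fun s => Derive_n_on D f 2 s / Derive_n_on D f 1 s) t
  - 1 / 2 * (Derive_n_on D f 2 t / Derive_n_on D f 1 t) ^ 2.

Lemma is_derive_on_interior (D : R -> Prop) (f : R -> R) (x l : R) :
  locally x D -> (is_derive_on D f x l <-> is_derive f x l).
Proof.
intros HD.
assert (E : forall P, within D (locally x) P <-> locally x P).
{ intros P; unfold within; split; intros H.
  - generalize (filter_and _ _ HD H); apply filter_imp; intros y [Hy HP]; auto.
  - revert H; apply filter_imp; auto. }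
unfold is_derive_on, is_derive.
split; intros [L H]; split; auto; intros z Hz eps.
- apply E, H. intros P HP; apply E, Hz, HP.
- apply E, H. intros P HP; apply E, Hz, HP.
Qed.

Lemma Derive_on_unique (I : R -> Prop) (f : R -> R) (x l : R) :
  is_interval I -> I x -> is_derive_on I f x l -> Derive_on I f x = l.
Proof.
intros [Hc (a & b & Ha & Hb & Hab)] Hx Hl.
assert (Hacc : forall d, 0 < d -> exists y, I y /\ y <> x /\ Rabs (y - x) < d).
{ intros d Hd; destruct (Rlt_le_dec x b) as [Hxb|Hbx].
  - pose proof (Rmin_l (x + d / 2) b); pose proof (Rmin_r (x + d / 2) b).
    assert (x < Rmin (x + d / 2) b) by (apply Rmin_glb_lt; lra).
    exists (Rmin (x + d / 2) b); repeat split.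
    + apply (Hc x b); auto; lra.
    + lra.
    + rewrite Rabs_pos_eq; lra.
  - pose proof (Rmax_l (x - d / 2) a); pose proof (Rmax_r (x - d / 2) a).
    assert (Rmax (x - d / 2) a < x) by (apply Rmax_lub_lt; lra).
    exists (Rmax (x - d / 2) a); repeat split.
    + apply (Hc a x); auto; lra.
    + lra.
    + rewrite Rabs_left; lra. }
assert (Hlim : is_filter_lim (within I (locally x)) x).
{ intros P HP; unfold within; revert HP; apply filter_imp; auto. }
unfold Derive_on; apply (@iota_unique R_AbsRing R_CompleteNormedModule);
  [|exact Hl].
intros m Hm; apply Rminus_diag_uniq.
destruct (Req_dec (m - l) 0) as [|Hne]; [assumption|exfalso].
pose proof (Rabs_pos_lt _ Hne) as Hpos.
assert (He : 0 < Rabs (m - l) / 4) by lra.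
destruct (filter_and _ _ (proj2 Hl x Hlim (mkposreal _ He))
            (proj2 Hm x Hlim (mkposreal _ He))) as [d Hd].
destruct (Hacc d (cond_pos d)) as (y & Iy & Hyx & Hyd).
assert (Hn : forall z : R, norm z = Rabs z) by reflexivity.
assert (Hy : ball x d y) by exact Hyd.
generalize (proj1 (Hd y Hy Iy)) (proj2 (Hd y Hy Iy)).
rewrite !Hn; change (R : Type) in m; simpl pos; intros A B.
change (Rabs (f y - f x - (y - x) * l) <= Rabs (m - l) / 4 * Rabs (y - x)) in A.
change (Rabs (f y - f x - (y - x) * m) <= Rabs (m - l) / 4 * Rabs (y - x)) in B.
assert (Hy0 : 0 < Rabs (y - x)) by (apply Rabs_pos_lt; lra).
assert (T := Rabs_triang (f y - f x - (y - x) * l)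
               (- (f y - f x - (y - x) * m))).
rewrite Rabs_Ropp in T.
replace (f y - f x - (y - x) * l + - (f y - f x - (y - x) * m))
  with ((m - l) * (y - x)) in T by ring.
rewrite Rabs_mult in T.
assert (0 < Rabs (m - l) * Rabs (y - x)) by (apply Rmult_lt_0_compat; assumption).
lra.
Qed.

Lemma Psi_intersection (h : R -> R) (u v : R) (p : R * R) :
  u <> v ->
  (line h u p /\ line h v p <-> p = (Psi_x h u v, Psi_y h u v)).
Proof.
intros Huv; destruct p as [x y]; unfold line, Psi_x, Psi_y; simpl; split.
- intros [H1 H2].
  assert (Hx : x = (h v - h u) / (u - v)).
  { apply (Rmult_eq_reg_r (u - v)); [|lra]. field_simplify; lra. }
  f_equal; [exact Hx|]. rewrite H1, Hx; field; lra.
- intros H; injection H; intros -> ->; split; field; lra.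
Qed.

(* Main.v *)
Require Import Defs.
From Stdlib Require Import Reals Lra ClassicalEpsilon.
From Coquelicot Require Import Coquelicot.
Open Scope R_scope.

(** Write [N(u,v) = h v - h u - h' u (v - u)] for the gap between [h] and its
    tangent at [u].  The intersection point satisfies [y = u x + h u = v x + h v],
    so [y_u = v x_u] and [y_v = u x_v], whence [J = (u - v) x_u x_v].  Since
    [x_u = - N(u,v) / (u - v)^2] and [x_v = - N(v,u) / (u - v)^2], this gives
    [J = N(u,v) N(v,u) / (u - v)^3] ([J_Psi_factorization]).  Taking the logarithm
    and differentiating in [v] and then in [u] yields a closed formula for
    [S_h - 1 / (v - u)^2] in terms of [h], [h'] and [h''] at [u] and [v]
    ([S_h_formula]).

    As [Rh] is continuous on the diagonal, [Rh t t] is the limit of that formula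
    with [u = t] fixed and [v] tending to [t].  With the fourth order Taylor
    expansion of [h] at [t] the singular terms cancel, and the limit is
    [h4 / (3 h2) - 4/9 (h3 / h2)^2], where [h2], [h3], [h4] are derivatives of [h]
    at [t] ([diagonal_limit]).

    Both geometric expressions reduce to the same number.  The velocity of the
    envelope is [- h'' (1, t)], so [det (gamma', gamma'') = h''^2] and
    [sigma' = (h''^2)^(1/3)].  Everything follows from the logarithmic derivative
    [sigma'' / sigma' = 2 h''' / (3 h'')]: the Schwarzian is read off from it
    ([schwarzian_arclength]), and three derivatives in [sigma], each computed as
    [d / d sigma = (1 / sigma') d / dt], give the curvature
    ([affine_curvature_envelope]).

    All derivatives are relative to an interval that may contain its endpoints.
    A function differentiable at [x] relative to [D] agrees on [D] with one that
    is differentiable at [x] in the usual sense ([is_derive_on_extension]), which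
    transfers the usual rules of calculus.  Precomposition with a clamp onto a
    segment transfers the mean value and intermediate value theorems. *)

(** * Calculus relative to a subset of the line *)

Lemma is_derive_on_iff (D : R -> Prop) (f : R -> R) (x l : R) :
  D x ->
  (is_derive_on D f x l <->
   forall eps : posreal, within D (locally x)
     (fun y => Rabs (f y - f x - l * (y - x)) <= eps * Rabs (y - x))).
Proof.
intros Dx.
assert (Hn : forall y, norm (minus (minus (f y) (f x)) (scal (minus y x) l))
                       = Rabs (f y - f x - l * (y - x))).
{ intros y; change (Rabs (f y - f x - (y - x) * l) = Rabs (f y - f x - l * (y - x))).
  f_equal; ring. }
split.
- intros [_ H] eps.
  assert (Hlim : is_filter_lim (within D (locally x)) x).
  { intros P HP; unfold within; revert HP; apply filter_imp; auto. }
  generalize (H x Hlim eps); apply filter_imp; intros y Hy.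
  rewrite <- Hn; exact Hy.
- intros H; split; [exact (@is_linear_scal_l R_AbsRing R_NormedModule l)|].
  intros z Hz eps.
  assert (z = x) as ->.
  { apply (@eq_close R_AbsRing R_NormedModule); intros e.
    destruct (Hz _ (locally_ball z e)) as [d Hd].
    exact (Hd x (ball_center x d) Dx). }
  generalize (H eps); apply filter_imp; intros y Hy.
  rewrite <- Hn in Hy; exact Hy.
Qed.

(** Off [D] the extension follows the tangent line at [x], so that the
    first-order estimate known on [D] holds on a full neighborhood. *)
Lemma is_derive_on_extension (D : R -> Prop) (f : R -> R) (x l : R) :
  D x -> is_derive_on D f x l ->
  exists g, (forall y, D y -> g y = f y) /\ is_derive g x l.
Proof.
intros Dx H.
set (g := fun y =>
  if excluded_middle_informative (D y) then f y else f x + l * (y - x)).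
assert (Hg : forall y, (D y -> g y = f y) /\ (~ D y -> g y = f x + l * (y - x))).
{ intros y; unfold g; destruct (excluded_middle_informative (D y)); tauto. }
exists g; split; [intros y; apply Hg|].
apply (is_derive_on_interior (fun _ => True)); [apply filter_forall; auto|].
apply is_derive_on_iff; [exact Logic.I|]; intros eps.
generalize (proj1 (is_derive_on_iff D f x l Dx) H eps).
unfold within; apply filter_imp; intros y Hy _; destruct (Hg y) as [H1 H2].
rewrite (proj1 (Hg x) Dx).
destruct (classic (D y)) as [d|n].
- rewrite (H1 d); auto.
- rewrite (H2 n); replace (f x + l * (y - x) - f x - l * (y - x)) with 0 by ring.
  rewrite Rabs_R0; apply Rmult_le_pos; [apply Rlt_le, eps|apply Rabs_pos].
Qed.

Lemma is_derive_on_ext_loc (D : R -> Prop) (f g : R -> R) (x l : R) :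
  D x -> within D (locally x) (fun y => f y = g y) ->
  is_derive_on D f x l -> is_derive_on D g x l.
Proof.
intros Dx E H; apply is_derive_on_iff; [assumption|]; intros eps.
assert (Ex : f x = g x) by exact (locally_singleton _ _ E Dx).
generalize (filter_and (F := within D (locally x)) _ _ E
  (proj1 (is_derive_on_iff D f x l Dx) H eps)).
apply filter_imp; intros y [Ey Hy].
rewrite <- Ex, <- Ey; auto.
Qed.

Lemma is_derive_on_ext (D : R -> Prop) (f g : R -> R) (x l : R) :
  D x -> (forall y, D y -> f y = g y) ->
  is_derive_on D f x l -> is_derive_on D g x l.
Proof.
intros Dx E; apply is_derive_on_ext_loc; [assumption|].
unfold within; apply filter_forall; exact E.
Qed.

Lemma is_derive_is_derive_on (D : R -> Prop) (f : R -> R) (x l : R) :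
  D x -> is_derive f x l -> is_derive_on D f x l.
Proof.
intros Dx H; apply is_derive_on_iff; [assumption|]; intros eps.
apply (is_derive_on_interior (fun _ => True)) in H; [|apply filter_forall; auto].
generalize (proj1 (is_derive_on_iff _ f x l Logic.I) H eps).
unfold within; apply filter_imp; auto.
Qed.

Lemma is_derive_on_subset (D E : R -> Prop) (f : R -> R) (x l : R) :
  E x -> (forall y, E y -> D y) ->
  is_derive_on D f x l -> is_derive_on E f x l.
Proof.
intros Ex ED H; apply is_derive_on_iff; [assumption|]; intros eps.
generalize (proj1 (is_derive_on_iff D f x l (ED x Ex)) H eps).
unfold within; apply filter_imp; auto.
Qed.

Lemma is_derive_on_continuous (D : R -> Prop) (f : R -> R) (x l : R) :
  D x -> is_derive_on D f x l ->
  filterlim f (within D (locally x)) (locally (f x)).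
Proof.
intros Dx H; destruct (is_derive_on_extension D f x l Dx H) as (g & E & Hg).
rewrite <- (E x Dx).
apply (filterlim_within_ext _ g); [exact E|].
eapply filterlim_filter_le_1; [apply filter_le_within|].
apply (@ex_derive_continuous R_AbsRing R_NormedModule); exists l; exact Hg.
Qed.

Lemma is_derive_on_comp (D E : R -> Prop) (f g : R -> R) (x df dg : R) :
  E x -> (forall y, E y -> D (g y)) ->
  is_derive_on D f (g x) df -> is_derive_on E g x dg ->
  is_derive_on E (fun y => f (g y)) x (df * dg).
Proof.
intros Ex ED Hf Hg.
destruct (is_derive_on_extension D f (g x) df (ED x Ex) Hf) as (f' & Ef & Hf').
destruct (is_derive_on_extension E g x dg Ex Hg) as (g' & Eg & Hg').
apply is_derive_on_ext with (fun y => f' (g' y)); [assumption| |].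
- intros y Ey; rewrite (Eg y Ey); auto.
- apply is_derive_is_derive_on; [assumption|].
  rewrite <- (Eg x Ex) in Hf'.
  rewrite Rmult_comm; exact (is_derive_comp f' g' x df dg Hf' Hg').
Qed.

Section Rules.
Variables (D : R -> Prop) (x : R) (Dx : D x).

Lemma is_derive_on_eq (f : R -> R) (l l' : R) :
  is_derive_on D f x l -> l = l' -> is_derive_on D f x l'.
Proof. intros H <-; exact H. Qed.

Lemma is_derive_on_const (c : R) : is_derive_on D (fun _ => c) x 0.
Proof.
apply is_derive_is_derive_on; [exact Dx|].
exact (@is_derive_const R_AbsRing R_NormedModule c x).
Qed.

Lemma is_derive_on_id : is_derive_on D (fun y => y) x 1.
Proof.
apply is_derive_is_derive_on; [exact Dx|]. exact (@is_derive_id R_AbsRing x).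
Qed.

Lemma is_derive_on_comp_real (phi f : R -> R) (l m : R) :
  is_derive_on D f x l -> is_derive phi (f x) m ->
  is_derive_on D (fun y => phi (f y)) x (m * l).
Proof.
intros Hf Hphi; apply (is_derive_on_comp (fun _ => True)); auto.
apply is_derive_is_derive_on; auto.
Qed.

Lemma is_derive_on_opp (f : R -> R) (l : R) :
  is_derive_on D f x l -> is_derive_on D (fun y => - f y) x (- l).
Proof.
intros Hf; apply is_derive_on_eq with (-1 * l); [|ring].
apply (is_derive_on_comp_real Ropp); [assumption|].
auto_derive; auto.
Qed.

Lemma is_derive_on_inv (f : R -> R) (l : R) :
  is_derive_on D f x l -> f x <> 0 ->
  is_derive_on D (fun y => / f y) x (- l / f x ^ 2).
Proof.
intros Hf H0; apply is_derive_on_eq with (- / f x ^ 2 * l); [|field; exact H0].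
apply (is_derive_on_comp_real Rinv); [assumption|].
auto_derive; [exact H0|field; exact H0].
Qed.

Lemma is_derive_on_pow (f : R -> R) (n : nat) (l : R) :
  is_derive_on D f x l ->
  is_derive_on D (fun y => f y ^ n) x (INR n * f x ^ pred n * l).
Proof.
intros Hf; apply (is_derive_on_comp_real (fun y => y ^ n)); [assumption|].
auto_derive; [exact Logic.I|ring].
Qed.

Lemma is_derive_on_plus (f g : R -> R) (l m : R) :
  is_derive_on D f x l -> is_derive_on D g x m ->
  is_derive_on D (fun y => f y + g y) x (l + m).
Proof.
intros Hf Hg.
destruct (is_derive_on_extension D f x l Dx Hf) as (f' & Ef & Hf').
destruct (is_derive_on_extension D g x m Dx Hg) as (g' & Eg & Hg').
apply is_derive_on_ext with (fun y => f' y + g' y); [assumption| |].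
- intros y Dy; rewrite Ef, Eg; auto.
- apply is_derive_is_derive_on; [assumption|].
  exact (is_derive_plus f' g' x l m Hf' Hg').
Qed.

Lemma is_derive_on_mult (f g : R -> R) (l m : R) :
  is_derive_on D f x l -> is_derive_on D g x m ->
  is_derive_on D (fun y => f y * g y) x (l * g x + f x * m).
Proof.
intros Hf Hg.
destruct (is_derive_on_extension D f x l Dx Hf) as (f' & Ef & Hf').
destruct (is_derive_on_extension D g x m Dx Hg) as (g' & Eg & Hg').
apply is_derive_on_ext with (fun y => f' y * g' y); [assumption| |].
- intros y Dy; rewrite Ef, Eg; auto.
- apply is_derive_is_derive_on; [assumption|].
  rewrite <- (Ef x Dx), <- (Eg x Dx).
  exact (is_derive_mult f' g' x l m Hf' Hg' Rmult_comm).
Qed.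

Lemma is_derive_on_minus (f g : R -> R) (l m : R) :
  is_derive_on D f x l -> is_derive_on D g x m ->
  is_derive_on D (fun y => f y - g y) x (l - m).
Proof.
intros Hf Hg; apply is_derive_on_plus; [|apply is_derive_on_opp]; assumption.
Qed.

Lemma is_derive_on_div (f g : R -> R) (l m : R) :
  is_derive_on D f x l -> is_derive_on D g x m -> g x <> 0 ->
  is_derive_on D (fun y => f y / g y) x ((l * g x - f x * m) / g x ^ 2).
Proof.
intros Hf Hg H0.
eapply is_derive_on_eq;
  [apply is_derive_on_mult; [exact Hf|apply is_derive_on_inv; [exact Hg|exact H0]]|].
simpl; field; exact H0.
Qed.

Lemma is_derive_on_ln_Rabs (f : R -> R) (l : R) :
  is_derive_on D f x l -> f x <> 0 ->
  is_derive_on D (fun y => ln (Rabs (f y))) x (l / f x).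
Proof.
intros Hf H0; apply is_derive_on_eq with (/ f x * l); [|field; exact H0].
apply (is_derive_on_comp_real (fun z => ln (Rabs z))); [assumption|].
auto_derive.
- split; [exact H0|split; [apply Rabs_pos_lt; exact H0|exact Logic.I]].
- destruct (Rlt_or_le (f x) 0) as [Hn|Hp].
  + rewrite sign_eq_m1, Rabs_left by assumption; field; exact H0.
  + rewrite sign_eq_1, Rabs_pos_eq by lra; field; exact H0.
Qed.

End Rules.

(** The rules are selected by the syntax of the function, after eta-expansion:
    letting unification choose would make it unfold [is_derive_on] and the real
    operations.  Derivatives of unknown functions come from the hypotheses, and
    the nonvanishing conditions of quotients and logarithms are left as goals. *)
Ltac derive_on_step :=
  try match goal with
  | |- is_derive_on ?D ?f ?x ?l =>
      let g := eval cbv beta in (fun y : R => f y) in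
      change (is_derive_on D g x l)
  end;
  match goal with
  | |- is_derive_on _ (fun _ => ?c) _ _ => apply is_derive_on_const
  | |- is_derive_on _ (fun y => y) _ _ => apply is_derive_on_id
  | H : is_derive_on ?D ?f ?x _ |- is_derive_on ?D ?f ?x _ => exact H
  | H : is_derive_on ?D ?f ?x _ |- is_derive_on ?D (fun y => ?f y) ?x _ => exact H
  | |- is_derive_on _ (fun y => @?f y / @?g y) _ _ => apply is_derive_on_div
  | |- is_derive_on _ (fun y => @?f y - @?g y) _ _ => apply is_derive_on_minus
  | |- is_derive_on _ (fun y => @?f y + @?g y) _ _ => apply is_derive_on_plus
  | |- is_derive_on _ (fun y => @?f y * @?g y) _ _ => apply is_derive_on_mult
  | |- is_derive_on _ (fun y => - @?f y) _ _ => apply is_derive_on_opp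
  | |- is_derive_on _ (fun y => ln (Rabs (@?f y))) _ _ => apply is_derive_on_ln_Rabs
  | |- is_derive_on _ (fun y => @?f y ^ ?n) _ _ => apply is_derive_on_pow
  | |- is_derive_on _ _ _ _ => fail 1
  | |- _ => assumption
  end.
Ltac derive_on := repeat derive_on_step.

(** * Mean values, monotonicity and inverse functions on an interval *)

Lemma interval_between (D : R -> Prop) (a b x : R) :
  is_interval D -> D a -> D b -> Rmin a b <= x <= Rmax a b -> D x.
Proof.
intros [HD _] Da Db; apply HD.
- unfold Rmin; destruct (Rle_dec a b); assumption.
- unfold Rmax; destruct (Rle_dec a b); assumption.
Qed.

Definition clamp (a b x : R) : R := Rmax a (Rmin b x).

Lemma clamp_bounds (a b x : R) : a <= b -> a <= clamp a b x <= b.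
Proof.
intros Hab; unfold clamp; split; [apply Rmax_l|].
apply Rmax_lub; [exact Hab|apply Rmin_l].
Qed.

Lemma clamp_id (a b x : R) : a <= x <= b -> clamp a b x = x.
Proof. intros H; unfold clamp; rewrite Rmin_right, Rmax_right; lra. Qed.

Lemma clamp_lipschitz (a b x y : R) :
  Rabs (clamp a b y - clamp a b x) <= Rabs (y - x).
Proof.
unfold clamp.
unfold Rmin; destruct (Rle_dec b x), (Rle_dec b y);
  unfold Rmax; repeat destruct (Rle_dec _ _);
  unfold Rabs; repeat destruct (Rcase_abs _); lra.
Qed.

(** The clamp turns continuity relative to [D] into continuity on the whole
    line without changing [f] between [a] and [b]. *)
Lemma clamp_continuity (D : R -> Prop) (f : R -> R) (a b : R) :
  a <= b -> (forall x, a <= x <= b -> D x) ->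
  (forall x, D x -> filterlim f (within D (locally x)) (locally (f x))) ->
  continuity (fun x => f (clamp a b x)).
Proof.
intros Hab Hsub Hf x; apply continuity_pt_filterlim.
apply (filterlim_comp _ _ _ (clamp a b) f _ (within D (locally (clamp a b x)))).
- intros P [d Hd]; exists d; intros y Hy.
  apply Hd; [|apply Hsub, clamp_bounds, Hab].
  eapply Rle_lt_trans; [apply clamp_lipschitz|exact Hy].
- apply Hf, Hsub, clamp_bounds, Hab.
Qed.

Lemma mean_value_on (D : R -> Prop) (f df : R -> R) (a b : R) :
  is_interval D -> (forall x, D x -> is_derive_on D f x (df x)) ->
  D a -> D b ->
  exists c, Rmin a b <= c <= Rmax a b /\ f b - f a = df c * (b - a).
Proof.
intros HD Hf Da Db.
set (p := Rmin a b); set (q := Rmax a b).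
assert (Hpq : p <= q) by apply Rminmax.
assert (Hsub : forall x, p <= x <= q -> D x)
  by (intros x; apply interval_between; assumption).
destruct (MVT_gen (fun x => f (clamp p q x)) a b df) as (c & Hc & E).
- intros x Hx; fold p q in Hx.
  apply is_derive_ext_loc with f.
  + apply (filter_imp (fun y => p < y < q)).
    * intros y Hy; rewrite clamp_id; [reflexivity|lra].
    * apply filter_and; [apply open_gt|apply open_lt]; lra.
  + apply (is_derive_on_interior D); [|apply Hf, Hsub; lra].
    apply (filter_imp (fun y => p < y < q)).
    * intros y Hy; apply Hsub; lra.
    * apply filter_and; [apply open_gt|apply open_lt]; lra.
- intros x _; apply (clamp_continuity D); [exact Hpq|exact Hsub|].
  intros y Dy; apply (is_derive_on_continuous D f y (df y)); auto.
- exists c; split; [exact Hc|].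
  rewrite !clamp_id in E; [exact E| |].
  + split; [apply Rmin_l|apply Rmax_l].
  + split; [apply Rmin_r|apply Rmax_r].
Qed.

Lemma intermediate_value_on (D : R -> Prop) (f df : R -> R) (a b y : R) :
  is_interval D -> (forall x, D x -> is_derive_on D f x (df x)) ->
  D a -> D b -> f a <= y <= f b -> exists c, D c /\ f c = y.
Proof.
intros HD Hf Da Db Hy.
set (p := Rmin a b); set (q := Rmax a b).
assert (Hpq : p <= q) by apply Rminmax.
assert (Hsub : forall x, p <= x <= q -> D x)
  by (intros x; apply interval_between; assumption).
assert (Hpa : p <= a <= q) by (split; [apply Rmin_l|apply Rmax_l]).
assert (Hpb : p <= b <= q) by (split; [apply Rmin_r|apply Rmax_r]).
destruct (IVT_gen (fun x => f (clamp p q x)) a b y) as (c & Hc & E).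
- apply (clamp_continuity D); [exact Hpq|exact Hsub|].
  intros x Dx; apply (is_derive_on_continuous D f x (df x)); auto.
- rewrite !clamp_id by assumption.
  rewrite Rmin_left, Rmax_right by lra; exact Hy.
- exists (clamp p q c); split; [|exact E].
  apply Hsub, clamp_bounds, Hpq.
Qed.

Lemma increasing_on (D : R -> Prop) (f df : R -> R) (a b : R) :
  is_interval D -> (forall x, D x -> is_derive_on D f x (df x)) ->
  (forall x, D x -> 0 < df x) -> D a -> D b -> a < b -> f a < f b.
Proof.
intros HD Hf Hpos Da Db Hab.
destruct (mean_value_on D f df a b HD Hf Da Db) as (c & Hc & E).
rewrite Rmin_left, Rmax_right in Hc by lra.
assert (Dc : D c) by (apply (proj1 HD a b); assumption).
pose proof (Rmult_lt_0_compat _ (b - a) (Hpos c Dc)); lra.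
Qed.

Lemma image_interval (D : R -> Prop) (f df : R -> R) :
  is_interval D -> (forall x, D x -> is_derive_on D f x (df x)) ->
  (forall x, D x -> 0 < df x) -> is_interval (image f D).
Proof.
intros HD Hf Hpos; split.
- intros a b y (x1 & D1 & <-) (x2 & D2 & <-) Hy.
  destruct (intermediate_value_on D f df x1 x2 y HD Hf D1 D2 Hy) as (c & Dc & E).
  exists c; auto.
- destruct (proj2 HD) as (a & b & Da & Db & Hab).
  exists (f a), (f b); repeat split; [exists a; auto|exists b; auto|].
  eapply increasing_on; eauto.
Qed.

(** A neighborhood of [x] is cut out by [x - d] and [x + d]; by monotonicity the
    values of [f] at those of the two points that lie in [D] bound the allowed
    deviation of [f], and a point outside [D] is never passed by convexity. *)
Lemma inverse_continuous_on (D : R -> Prop) (f df g : R -> R) (x : R) :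
  is_interval D -> (forall x, D x -> is_derive_on D f x (df x)) ->
  (forall x, D x -> 0 < df x) -> (forall x, D x -> g (f x) = x) -> D x ->
  filterlim g (within (image f D) (locally (f x))) (within D (locally x)).
Proof.
intros HD Hf Hpos Hg Dx P [d Hd].
assert (Hup : exists e : posreal, forall z, D z -> f z < f x + e -> z < x + d).
{ destruct (classic (D (x + d))) as [Dd|Nd].
  - assert (Hlt : f x < f (x + d)).
    { apply (increasing_on D f df); auto; pose proof (cond_pos d); lra. }
    exists (mkposreal (f (x + d) - f x) (proj2 (Rlt_0_minus _ _) Hlt));
      simpl; intros z Dz Hz.
    apply Rnot_le_lt; intros [Hlt'| <-]; [|lra].
    pose proof (increasing_on D f df _ _ HD Hf Hpos Dd Dz Hlt'); lra.
  - exists d; intros z Dz _; apply Rnot_le_lt; intros Hle; apply Nd.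
    apply (proj1 HD x z); auto; pose proof (cond_pos d); lra. }
assert (Hlow : exists e : posreal, forall z, D z -> f x - e < f z -> x - d < z).
{ destruct (classic (D (x - d))) as [Dd|Nd].
  - assert (Hlt : f (x - d) < f x).
    { apply (increasing_on D f df); auto; pose proof (cond_pos d); lra. }
    exists (mkposreal (f x - f (x - d)) (proj2 (Rlt_0_minus _ _) Hlt));
      simpl; intros z Dz Hz.
    apply Rnot_le_lt; intros [Hlt'| ->]; [|lra].
    pose proof (increasing_on D f df _ _ HD Hf Hpos Dz Dd Hlt'); lra.
  - exists d; intros z Dz _; apply Rnot_le_lt; intros Hle; apply Nd.
    apply (proj1 HD z x); auto; pose proof (cond_pos d); lra. }
destruct Hup as [e1 H1], Hlow as [e2 H2].
exists (mkposreal _ (Rmin_stable_in_posreal e1 e2)); intros s Hs (z & Dz & <-).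
change (Rabs (f z - f x) < Rmin e1 e2) in Hs.
pose proof (Rmin_l e1 e2); pose proof (Rmin_r e1 e2).
apply Rabs_def2 in Hs.
rewrite (Hg z Dz); apply Hd; [|exact Dz].
change (Rabs (z - x) < d).
apply Rabs_def1; [pose proof (H1 z Dz)|pose proof (H2 z Dz)]; lra.
Qed.

(** With [A = f z - f x] and [B = z - x], the error to bound is
    [B - A / f'(x) = - (A - f'(x) B) / f'(x)].  The differentiability of [f] makes
    it small compared with [B], and [|B|] is at most [2 |A| / f'(x)]. *)
Lemma is_derive_on_inverse (D : R -> Prop) (f df g : R -> R) (x : R) :
  is_interval D -> (forall x, D x -> is_derive_on D f x (df x)) ->
  (forall x, D x -> 0 < df x) -> (forall x, D x -> g (f x) = x) -> D x ->
  is_derive_on (image f D) g (f x) (/ df x).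
Proof.
intros HD Hf Hpos Hg Dx.
assert (Hp := Hpos x Dx).
apply is_derive_on_iff; [exists x; auto|]; intros eps.
rewrite (Hg x Dx).
(* The first bound gives [|B| <= 2 |A| / f'(x)], the second turns the error
   [eta |B| / f'(x)] into at most [eps |A|]. *)
set (eta := Rmin (df x / 2) (eps * (df x) ^ 2 / 2)).
assert (Heta : 0 < eta).
{ apply Rmin_glb_lt; [lra|].
  pose proof (Rmult_lt_0_compat _ _ (cond_pos eps) (pow_lt _ 2 Hp)); lra. }
assert (He1 : eta <= df x / 2) by apply Rmin_l.
assert (He2 : eta <= eps * (df x) ^ 2 / 2) by apply Rmin_r.
generalize (inverse_continuous_on D f df g x HD Hf Hpos Hg Dx _
  (proj1 (is_derive_on_iff D f x _ Dx) (Hf x Dx) (mkposreal _ Heta))).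
unfold filtermap, within; apply filter_imp.
intros s Hs (z & Dz & <-); specialize (Hs (ex_intro _ z (conj Dz eq_refl))).
rewrite (Hg z Dz) in *; simpl in Hs.
set (A := f z - f x) in *; set (B := z - x) in *.
assert (Hb : df x * Rabs B <= Rabs A + eta * Rabs B).
{ rewrite <- (Rabs_pos_eq (df x)) by lra; rewrite <- Rabs_mult.
  replace (df x * B) with (A + - (A - df x * B)) by ring.
  eapply Rle_trans; [apply Rabs_triang|]; rewrite Rabs_Ropp; lra. }
assert (HB : df x / 2 * Rabs B <= Rabs A).
{ pose proof (Rmult_le_compat_r _ _ _ (Rabs_pos B) He1); lra. }
replace (B - / df x * A) with (- (/ df x * (A - df x * B))) by (field; lra).
rewrite Rabs_Ropp, Rabs_mult, (Rabs_pos_eq (/ df x))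
  by (apply Rlt_le, Rinv_0_lt_compat, Hp).
apply (Rmult_le_reg_l (df x)); [exact Hp|].
rewrite <- Rmult_assoc, Rinv_r, Rmult_1_l by lra.
eapply Rle_trans; [exact Hs|].
eapply Rle_trans; [apply Rmult_le_compat_r; [apply Rabs_pos|exact He2]|].
replace (eps * df x ^ 2 / 2 * Rabs B) with (eps * df x * (df x / 2 * Rabs B)) by field.
replace (df x * (eps * Rabs A)) with (eps * df x * Rabs A) by ring.
apply Rmult_le_compat_l; [|exact HB].
apply Rlt_le, Rmult_lt_0_compat; [apply eps|exact Hp].
Qed.

(** * Taylor-Young expansions and limits at a punctured point *)

Definition little_o (D : R -> Prop) (t : R) (k : nat) (G : R -> R) : Prop :=
  forall eps : posreal,
    within D (locally t) (fun v => Rabs (G v) <= eps * Rabs (v - t) ^ k).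

Lemma little_o_deriv (D : R -> Prop) (t l : R) (f : R -> R) :
  D t -> is_derive_on D f t l ->
  little_o D t 1 (fun v => f v - f t - l * (v - t)).
Proof.
intros Dt H eps; generalize (proj1 (is_derive_on_iff D f t l Dt) H eps).
apply filter_imp; intros v; simpl; rewrite Rmult_1_r; auto.
Qed.

(** One step of the Taylor-Young formula: by the mean value theorem
    [G v = G'(c) (v - t)] with [c] between [t] and [v]. *)
Lemma little_o_primitive (D : R -> Prop) (t : R) (k : nat) (G G' : R -> R) :
  is_interval D -> D t -> (forall x, D x -> is_derive_on D G x (G' x)) ->
  G t = 0 -> little_o D t k G' -> little_o D t (S k) G.
Proof.
intros HD Dt HG G0 H eps; destruct (H eps) as [d Hd].
exists d; intros v Hv Dv.
destruct (mean_value_on D G G' t v HD HG Dt Dv) as (c & Hc & E).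
assert (Dc : D c) by (apply (interval_between D t v); assumption).
assert (Hcv : Rabs (c - t) <= Rabs (v - t)).
{ revert Hc; unfold Rmin, Rmax; destruct (Rle_dec t v); intros Hc;
    unfold Rabs; repeat destruct (Rcase_abs _); lra. }
assert (Hc' : Rabs (G' c) <= eps * Rabs (c - t) ^ k).
{ apply Hd; [|exact Dc]. eapply Rle_lt_trans; [exact Hcv|exact Hv]. }
rewrite G0, Rminus_0_r in E; rewrite E, Rabs_mult; simpl.
replace (eps * (Rabs (v - t) * Rabs (v - t) ^ k))
  with (eps * Rabs (v - t) ^ k * Rabs (v - t)) by ring.
apply Rmult_le_compat_r; [apply Rabs_pos|].
eapply Rle_trans; [exact Hc'|].
apply Rmult_le_compat_l; [apply Rlt_le, eps|].
apply pow_incr; split; [apply Rabs_pos|exact Hcv].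
Qed.

Definition punctured (D : R -> Prop) (t : R) : (R -> Prop) -> Prop :=
  within (fun v => D v /\ v <> t) (locally t).

Lemma punctured_proper (D : R -> Prop) (t : R) :
  is_interval D -> D t -> ProperFilter (punctured D t).
Proof.
intros HD Dt; constructor; [|apply within_filter, locally_filter].
intros P [d Hd].
assert (exists y, D y /\ y <> t /\ Rabs (y - t) < d) as (y & Dy & Hy & Hyd).
{ destruct HD as [Hc (a & b & Da & Db & Hab)]; pose proof (cond_pos d).
  destruct (Rlt_le_dec t b) as [Htb|Hbt].
  - pose proof (Rmin_l (t + d / 2) b); pose proof (Rmin_r (t + d / 2) b).
    assert (t < Rmin (t + d / 2) b) by (apply Rmin_glb_lt; lra).
    exists (Rmin (t + d / 2) b); repeat split.
    + apply (Hc t b); auto; lra.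
    + lra.
    + rewrite Rabs_pos_eq; lra.
  - pose proof (Rmax_l (t - d / 2) a); pose proof (Rmax_r (t - d / 2) a).
    assert (Rmax (t - d / 2) a < t) by (apply Rmax_lub_lt; lra).
    exists (Rmax (t - d / 2) a); repeat split.
    + apply (Hc a t); auto; lra.
    + lra.
    + rewrite Rabs_left; lra. }
exists y; apply Hd; [exact Hyd|split; assumption].
Qed.

Lemma within_punctured (D : R -> Prop) (t : R) (P : R -> Prop) :
  within D (locally t) P -> punctured D t P.
Proof.
unfold punctured, within; apply filter_imp; intros v Hv [Dv _]; auto.
Qed.

Lemma punctured_domain (D : R -> Prop) (t : R) :
  punctured D t (fun v => D v /\ v <> t).
Proof. unfold punctured, within; apply filter_forall; auto. Qed.

Lemma little_o_filterlim (D : R -> Prop) (t : R) (k : nat) (G : R -> R) :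
  little_o D t k G ->
  filterlim (fun v => G v / (v - t) ^ k) (punctured D t) (locally 0).
Proof.
intros H; apply filterlim_locally; intros eps.
generalize (filter_and (F := punctured D t) _ _ (punctured_domain D t)
              (within_punctured D t _ (H (pos_div_2 eps)))).
apply filter_imp; intros v [[Dv Hvt] Hv].
change (Rabs (G v / (v - t) ^ k - 0) < eps).
assert (Hpos : 0 < Rabs (v - t) ^ k) by (apply pow_lt, Rabs_pos_lt; lra).
rewrite Rminus_0_r, Rabs_div, <- RPow_abs by (apply pow_nonzero; lra).
apply (Rmult_lt_reg_r (Rabs (v - t) ^ k)); [exact Hpos|].
unfold Rdiv; rewrite Rmult_assoc, Rinv_l, Rmult_1_r by lra.
eapply Rle_lt_trans; [exact Hv|]; simpl.
apply Rmult_lt_compat_r; [exact Hpos|]; pose proof (cond_pos eps); lra.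
Qed.

Section Limits.
Context {F : (R -> Prop) -> Prop} {FF : Filter F}.

Lemma lim_plus (f g : R -> R) (l m : R) :
  filterlim f F (locally l) -> filterlim g F (locally m) ->
  filterlim (fun v => f v + g v) F (locally (l + m)).
Proof.
intros Hf Hg; eapply filterlim_comp_2; [exact Hf|exact Hg|].
exact (@filterlim_plus R_AbsRing R_NormedModule l m).
Qed.

Lemma lim_mult (f g : R -> R) (l m : R) :
  filterlim f F (locally l) -> filterlim g F (locally m) ->
  filterlim (fun v => f v * g v) F (locally (l * m)).
Proof.
intros Hf Hg; eapply filterlim_comp_2; [exact Hf|exact Hg|].
exact (@filterlim_mult R_AbsRing l m).
Qed.

Lemma lim_continuous (phi f : R -> R) (l : R) :
  continuous phi l -> filterlim f F (locally l) ->
  filterlim (fun v => phi (f v)) F (locally (phi l)).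
Proof. intros Hp Hf; eapply filterlim_comp; [exact Hf|exact Hp]. Qed.

Lemma lim_opp (f : R -> R) (l : R) :
  filterlim f F (locally l) -> filterlim (fun v => - f v) F (locally (- l)).
Proof.
apply (lim_continuous Ropp).
apply (@filterlim_opp R_AbsRing R_NormedModule l).
Qed.

Lemma lim_minus (f g : R -> R) (l m : R) :
  filterlim f F (locally l) -> filterlim g F (locally m) ->
  filterlim (fun v => f v - g v) F (locally (l - m)).
Proof. intros; apply lim_plus; [|apply lim_opp]; assumption. Qed.

Lemma lim_const (c : R) : filterlim (fun _ => c) F (locally c).
Proof. apply filterlim_const. Qed.

Lemma lim_pow (f : R -> R) (n : nat) (l : R) :
  filterlim f F (locally l) -> filterlim (fun v => f v ^ n) F (locally (l ^ n)).
Proof.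
intros H; induction n as [|n IH]; simpl; [apply lim_const|].
apply lim_mult; assumption.
Qed.

Lemma lim_div (f g : R -> R) (l m : R) :
  filterlim f F (locally l) -> filterlim g F (locally m) -> m <> 0 ->
  filterlim (fun v => f v / g v) F (locally (l / m)).
Proof.
intros Hf Hg Hm; apply lim_mult; [exact Hf|].
apply (lim_continuous Rinv); [apply continuous_Rinv, Hm|exact Hg].
Qed.

Lemma lim_eq (f : R -> R) (l m : R) :
  filterlim f F (locally l) -> l = m -> filterlim f F (locally m).
Proof. intros H <-; exact H. Qed.

Lemma lim_ext (f g : R -> R) (l : R) :
  F (fun v => f v = g v) -> filterlim f F (locally l) -> filterlim g F (locally l).
Proof. apply filterlim_ext_loc. Qed.

Lemma lim_nonzero (f : R -> R) (l : R) :
  filterlim f F (locally l) -> l <> 0 -> F (fun v => f v <> 0).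
Proof.
intros Hf Hl; apply (Hf (fun y => y <> 0)).
exists (mkposreal _ (Rabs_pos_lt _ Hl)); intros y Hy ->.
change (Rabs (0 - l) < Rabs l) in Hy.
rewrite Rminus_0_l, Rabs_Ropp in Hy; lra.
Qed.

End Limits.

Ltac lim_step :=
  first
  [ eassumption
  | apply lim_const
  | apply lim_div
  | apply lim_minus
  | apply lim_plus
  | apply lim_mult
  | apply lim_opp
  | apply lim_pow ].

(** The closed form of [S_h u v - 1 / (v - u)^2] (see [S_h_formula]), with
    [a = h'' u], [w = h'' v], [d = v - u], and [n], [m] the tangent gaps at [u]
    and [v] divided by [d^2]. *)
Definition regularized (a w n m d : R) : R :=
  (a * m ^ 3 + w * n ^ 3 - 4 * m ^ 2 * n ^ 2) / (d ^ 2 * m ^ 2 * n ^ 2).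

(** In [n = a/2 + d n1], [m = a/2 + d m1], [w = a + d w1] the numerator of
    [regularized] has no constant term in [d], and its linear coefficient is
    [a^3 / 8] times [w1 - 2 n1 - 2 m1].  That combination is again divisible by [d],
    since the limits satisfy [b = 2 b/6 + 2 b/3], so the factor [d^2] in the
    denominator cancels. *)
Lemma regularized_limit {F : (R -> Prop) -> Prop} {FF : Filter F}
    (a b c : R) (d n1 m1 w1 r : R -> R) :
  a <> 0 ->
  F (fun v => d v <> 0) ->
  F (fun v => w1 v - 2 * n1 v - 2 * m1 v = d v * r v) ->
  filterlim d F (locally 0) ->
  filterlim n1 F (locally (b / 6)) ->
  filterlim m1 F (locally (b / 3)) ->
  filterlim w1 F (locally b) ->
  filterlim r F (locally (c / 6)) ->
  filterlim (fun v => regularized a (a + d v * w1 v)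
                        (a / 2 + d v * n1 v) (a / 2 + d v * m1 v) (d v))
    F (locally (c / (3 * a) - 4 / 9 * (b / a) ^ 2)).
Proof.
intros Ha Hd0 Hrel Hd Hn Hm Hw Hr.
assert (Ln : filterlim (fun v => a / 2 + d v * n1 v) F (locally (a / 2))).
{ eapply lim_eq; [repeat lim_step|ring]. }
assert (Lm : filterlim (fun v => a / 2 + d v * m1 v) F (locally (a / 2))).
{ eapply lim_eq; [repeat lim_step|ring]. }
(* The numerator divided by [d^2], sorted by powers of [d]. *)
apply lim_ext with (fun v =>
  (a ^ 3 / 8 * r v
   + (a ^ 2 / 2 * (m1 v ^ 2 + n1 v ^ 2) + 3 / 4 * a ^ 2 * (w1 v * n1 v)
      - 4 * a ^ 2 * (m1 v * n1 v))
   + d v * (a * m1 v ^ 3 + 3 / 2 * a * (w1 v * n1 v ^ 2) + a * n1 v ^ 3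
      - 4 * a * (m1 v * n1 v ^ 2 + n1 v * m1 v ^ 2))
   + d v ^ 2 * (w1 v * n1 v ^ 3 - 4 * (m1 v ^ 2 * n1 v ^ 2)))
  / ((a / 2 + d v * m1 v) ^ 2 * (a / 2 + d v * n1 v) ^ 2)).
- assert (Ha2 : a / 2 <> 0) by lra.
  generalize (filter_and _ _ (filter_and _ _ Hd0 Hrel)
    (filter_and _ _ (lim_nonzero _ _ Ln Ha2) (lim_nonzero _ _ Lm Ha2))).
  apply filter_imp; intros v [[D0 E] [N0 M0]]; unfold regularized.
  assert (E' : w1 v = 2 * n1 v + 2 * m1 v + d v * r v) by lra.
  rewrite E'; field; repeat split; lra.
- eapply lim_eq; [repeat lim_step|].
  + repeat apply Rmult_integral_contrapositive_currified; lra.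
  + field; exact Ha.
Qed.

(** * The Jacobian of the intersection map near the diagonal *)

(** A function together with its successive derivatives; this avoids carrying
    the choice operator behind [Derive_on] through the computations. *)
Definition jet (D : R -> Prop) (j : nat -> R -> R) : Prop :=
  forall k x, D x -> is_derive_on D (j k) x (j (S k) x).

Lemma smooth_jet (D : R -> Prop) (f : R -> R) :
  is_interval D -> smooth_on D f -> jet D (Derive_n_on D f).
Proof.
intros HD Hf k x Dx; destruct (Hf k x Dx) as [l Hl]; simpl.
rewrite (Derive_on_unique D _ x l HD Dx Hl); exact Hl.
Qed.

Definition tangent_gap (j : nat -> R -> R) (u v : R) : R :=
  j 0%nat v - j 0%nat u - j 1%nat u * (v - u).

Section Net.
Variables (I : R -> Prop) (HI : is_interval I).
Variables (j : nat -> R -> R) (Hj : jet I j).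

Let j0 u (Iu : I u) : is_derive_on I (j 0%nat) u (j 1%nat u) := Hj 0%nat u Iu.
Let j1 u (Iu : I u) : is_derive_on I (j 1%nat) u (j 2%nat u) := Hj 1%nat u Iu.
Let j2 u (Iu : I u) : is_derive_on I (j 2%nat) u (j 3%nat u) := Hj 2%nat u Iu.

Lemma tangent_gap_deriv_l (u v : R) :
  I u -> is_derive_on I (fun u' => tangent_gap j u' v) u (- j 2%nat u * (v - u)).
Proof.
intros Iu; pose proof (j0 u Iu); pose proof (j1 u Iu).
unfold tangent_gap; eapply is_derive_on_eq; [derive_on|simpl; ring].
Qed.

Lemma tangent_gap_deriv_r (u v : R) :
  I v -> is_derive_on I (fun v' => tangent_gap j u v') v (j 1%nat v - j 1%nat u).
Proof.
intros Iv; pose proof (j0 v Iv).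
unfold tangent_gap; eapply is_derive_on_eq; [derive_on|simpl; ring].
Qed.

(** This is [J = (u - v) x_u x_v], where [x_u] and [x_v] are tangent gaps up to
    the factor [- 1 / (u - v)^2]. *)
Lemma J_Psi_factorization (u v : R) :
  I u -> I v -> u <> v ->
  J_Psi I (j 0%nat) u v
  = tangent_gap j u v * tangent_gap j v u / (u - v) ^ 3.
Proof.
intros Iu Iv Huv; pose proof (j0 u Iu); pose proof (j0 v Iv).
assert (Hd : u - v <> 0) by lra.
assert (Xu : D1 I (Psi_x (j 0%nat)) u v = - tangent_gap j u v / (u - v) ^ 2).
{ apply Derive_on_unique; auto; unfold Psi_x, tangent_gap.
  eapply is_derive_on_eq; [derive_on|simpl; field; exact Hd]. }
assert (Xv : D2 I (Psi_x (j 0%nat)) u v = - tangent_gap j v u / (u - v) ^ 2).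
{ apply Derive_on_unique; auto; unfold Psi_x, tangent_gap.
  eapply is_derive_on_eq; [derive_on|simpl; field; exact Hd]. }
assert (Yu : D1 I (Psi_y (j 0%nat)) u v = - v * tangent_gap j u v / (u - v) ^ 2).
{ apply Derive_on_unique; auto; unfold Psi_y, tangent_gap.
  eapply is_derive_on_eq; [derive_on|simpl; field; exact Hd]. }
assert (Yv : D2 I (Psi_y (j 0%nat)) u v = - u * tangent_gap j v u / (u - v) ^ 2).
{ apply Derive_on_unique; auto; unfold Psi_y, tangent_gap.
  eapply is_derive_on_eq; [derive_on|simpl; field; exact Hd]. }
unfold J_Psi; rewrite Xu, Xv, Yu, Yv; field; exact Hd.
Qed.

Lemma within_neq (u v : R) : u <> v -> within I (locally u) (fun y => y <> v).
Proof.
intros H; unfold within.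
apply (filter_imp (fun y => y <> v)); [auto|apply open_neq, H].
Qed.

Lemma D2_log_J_Psi (u v : R) :
  I u -> I v -> u <> v -> tangent_gap j u v <> 0 -> tangent_gap j v u <> 0 ->
  D2 I (fun u v => ln (Rabs (J_Psi I (j 0%nat) u v))) u v
  = (j 1%nat v - j 1%nat u) / tangent_gap j u v
    - j 2%nat v * (u - v) / tangent_gap j v u + 3 / (u - v).
Proof.
intros Iu Iv Huv HN HM.
pose proof (tangent_gap_deriv_l v u Iv); pose proof (tangent_gap_deriv_r u v Iv).
assert (Hd : u - v <> 0) by lra.
apply Derive_on_unique; auto.
apply is_derive_on_ext_loc with
  (fun v' => ln (Rabs (tangent_gap j u v' * tangent_gap j v' u / (u - v') ^ 3))).
- exact Iv.
- generalize (within_neq v u (not_eq_sym Huv)).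
  unfold within; apply filter_imp; intros y Hy Iy.
  rewrite J_Psi_factorization; auto using not_eq_sym.
- eapply is_derive_on_eq; [derive_on|].
  + apply pow_nonzero, Hd.
  + unfold Rdiv; repeat apply Rmult_integral_contrapositive_currified; auto.
    apply Rinv_neq_0_compat, pow_nonzero, Hd.
  + simpl; field; repeat split; assumption.
Qed.

(** The factor [(u - v)^3] of [J_Psi] contributes [- 3 / (u - v)^2] to [S_h],
    which together with [- 1 / (v - u)^2] gives the term [- 4] in the numerator of
    [regularized]. *)
Lemma S_h_formula (u v : R) :
  I u -> I v -> u <> v -> tangent_gap j u v <> 0 -> tangent_gap j v u <> 0 ->
  S_h I (j 0%nat) u v - 1 / (v - u) ^ 2
  = regularized (j 2%nat u) (j 2%nat v)
      (tangent_gap j u v / (v - u) ^ 2) (tangent_gap j v u / (v - u) ^ 2) (v - u).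
Proof.
intros Iu Iv Huv HN HM.
pose proof (tangent_gap_deriv_l u v Iu) as HNu.
pose proof (tangent_gap_deriv_r v u Iu) as HMu.
pose proof (j1 u Iu).
assert (Hd : u - v <> 0) by lra.
assert (ES : S_h I (j 0%nat) u v =
  (- j 2%nat u * tangent_gap j u v
    + (j 1%nat v - j 1%nat u) * (j 2%nat u * (v - u))) / tangent_gap j u v ^ 2
  - (j 2%nat v * tangent_gap j v u
    - j 2%nat v * (u - v) * (j 1%nat u - j 1%nat v)) / tangent_gap j v u ^ 2
  - 3 / (u - v) ^ 2).
{ apply Derive_on_unique; auto.
  apply is_derive_on_ext_loc with (fun u' =>
    (j 1%nat v - j 1%nat u') / tangent_gap j u' v
    - j 2%nat v * (u' - v) / tangent_gap j v u' + 3 / (u' - v)).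
  - exact Iu.
  (* The formula for the inner derivative is needed for all [u'] near [u]: there
     both gaps stay nonzero by continuity. *)
  - pose proof (lim_nonzero (F := within I (locally u)) _ _
      (is_derive_on_continuous _ _ _ _ Iu HNu) HN) as EN.
    pose proof (lim_nonzero (F := within I (locally u)) _ _
      (is_derive_on_continuous _ _ _ _ Iu HMu) HM) as EM.
    generalize (filter_and (F := within I (locally u)) _ _
      (within_neq u v Huv)
      (filter_and (F := within I (locally u)) _ _ EN EM)).
    unfold within; apply filter_imp; intros y Hy Iy.
    destruct (Hy Iy) as (Hyv & Ny & My).
    rewrite D2_log_J_Psi; auto.
  - eapply is_derive_on_eq; [derive_on; assumption|].
    simpl; field; repeat split; assumption. }
assert (Hd' : v - u <> 0) by lra.
(* The two tangent gaps add up to [(h' v - h' u) (v - u)], which eliminates [h']. *)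
assert (Hp : (j 1%nat v - j 1%nat u) * (v - u)
             = tangent_gap j u v + tangent_gap j v u)
  by (unfold tangent_gap; ring).
assert (Hp' : j 1%nat v - j 1%nat u
              = (tangent_gap j u v + tangent_gap j v u) / (v - u))
  by (rewrite <- Hp; field; exact Hd').
assert (Hp'' : j 1%nat u - j 1%nat v
              = - (tangent_gap j u v + tangent_gap j v u) / (v - u))
  by (rewrite <- Hp; field; exact Hd').
rewrite ES, Hp', Hp''; unfold regularized; field; repeat split; assumption.
Qed.

(** Fixing [u = t] reduces the limit on the diagonal to one-variable Taylor
    expansions at [t]: of [h] to order 4, of [h'] to order 3, and of [h''] to
    order 2. *)
Lemma diagonal_limit (t : R) :
  I t -> j 2%nat t <> 0 ->
  filterlim (fun v => S_h I (j 0%nat) t v - 1 / (v - t) ^ 2) (punctured I t)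
    (locally (j 4%nat t / (3 * j 2%nat t) - 4 / 9 * (j 3%nat t / j 2%nat t) ^ 2)).
Proof.
intros It Ha.
set (a := j 2%nat t) in *; set (b := j 3%nat t); set (c := j 4%nat t).
set (T2 := fun v => j 2%nat v - a - b * (v - t) - c * (v - t) ^ 2 / 2).
set (T1 := fun v => j 1%nat v - j 1%nat t - a * (v - t) - b * (v - t) ^ 2 / 2
                    - c * (v - t) ^ 3 / 6).
set (T0 := fun v => j 0%nat v - j 0%nat t - j 1%nat t * (v - t)
                    - a * (v - t) ^ 2 / 2 - b * (v - t) ^ 3 / 6
                    - c * (v - t) ^ 4 / 24).
assert (O2 : little_o I t 2 T2).
{ apply (little_o_primitive I t 1%nat T2 (fun v => j 3%nat v - b - c * (v - t))); auto.
  - intros x Ix; pose proof (j2 x Ix); unfold T2.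
    eapply is_derive_on_eq; [derive_on; lra|simpl; field].
  - unfold T2, a; field.
  - apply little_o_deriv; [exact It|exact (Hj 3%nat t It)]. }
assert (O1 : little_o I t 3 T1).
{ apply (little_o_primitive I t 2%nat T1 T2); auto.
  - intros x Ix; pose proof (j1 x Ix); unfold T1, T2.
    eapply is_derive_on_eq; [derive_on; lra|simpl; field].
  - unfold T1; field. }
assert (O0 : little_o I t 4 T0).
{ apply (little_o_primitive I t 3%nat T0 T1); auto.
  - intros x Ix; pose proof (j0 x Ix); unfold T0, T1.
    eapply is_derive_on_eq; [derive_on; lra|simpl; field].
  - unfold T0; field. }
assert (FF : Filter (punctured I t)) by apply (punctured_proper I t HI It).
apply little_o_filterlim in O0, O1, O2.
set (e0 := fun v => T0 v / (v - t) ^ 4) in O0.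
set (e1 := fun v => T1 v / (v - t) ^ 3) in O1.
set (e2 := fun v => T2 v / (v - t) ^ 2) in O2.
assert (Ld : filterlim (fun v => v - t) (punctured I t) (locally 0)).
{ apply lim_eq with (t - t); [|ring].
  apply lim_minus; [|apply lim_const].
  eapply filterlim_filter_le_1; [apply filter_le_within|apply filterlim_id]. }
(* [e0], [e1], [e2] are the normalized remainders, so that [n1], [m1], [w1] are
   exact; for [m1], the gap at [v] is [(h' v - h' t) (v - t)] minus the gap at
   [t]. *)
set (n1 := fun v => b / 6 + (c / 24 + e0 v) * (v - t)).
set (m1 := fun v => b / 3 + (c / 8 + e1 v - e0 v) * (v - t)).
set (w1 := fun v => b + (c / 2 + e2 v) * (v - t)).
assert (Ln : filterlim n1 (punctured I t) (locally (b / 6))).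
{ eapply lim_eq; [unfold n1; repeat lim_step; lra|field]. }
assert (Lm : filterlim m1 (punctured I t) (locally (b / 3))).
{ eapply lim_eq; [unfold m1; repeat lim_step; lra|field]. }
assert (Lw : filterlim w1 (punctured I t) (locally b)).
{ eapply lim_eq; [unfold w1; repeat lim_step; lra|field]. }
assert (Hdom := punctured_domain I t).
apply lim_ext with (fun v => regularized a (a + (v - t) * w1 v)
  (a / 2 + (v - t) * n1 v) (a / 2 + (v - t) * m1 v) (v - t)).
- assert (Ha2 : a / 2 <> 0) by lra.
  assert (En : punctured I t (fun v => a / 2 + (v - t) * n1 v <> 0)).
  { apply lim_nonzero with (a / 2); [|exact Ha2].
    eapply lim_eq; [repeat lim_step; lra|field]. }
  assert (Em : punctured I t (fun v => a / 2 + (v - t) * m1 v <> 0)).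
  { apply lim_nonzero with (a / 2); [|exact Ha2].
    eapply lim_eq; [repeat lim_step; lra|field]. }
  generalize (filter_and _ _ Hdom (filter_and _ _ En Em)).
  apply filter_imp; intros v [[Iv Hv] [Nv Mv]].
  assert (Hd : v - t <> 0) by lra.
  assert (EN : a / 2 + (v - t) * n1 v = tangent_gap j t v / (v - t) ^ 2).
  { unfold n1, e0, T0, tangent_gap; field; exact Hd. }
  assert (EM : a / 2 + (v - t) * m1 v = tangent_gap j v t / (v - t) ^ 2).
  { unfold m1, e0, e1, T0, T1, tangent_gap; field; exact Hd. }
  assert (EW : a + (v - t) * w1 v = j 2%nat v).
  { unfold w1, e2, T2; field; exact Hd. }
  rewrite EN in Nv |- *; rewrite EM in Mv |- *; rewrite EW.
  symmetry; apply S_h_formula; auto.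
  + intros E; apply Nv; rewrite E; field; exact Hd.
  + intros E; apply Mv; rewrite E; field; exact Hd.
- apply (regularized_limit a b c (fun v => v - t) n1 m1 w1
           (fun v => c / 6 + e2 v - 2 * e1 v)); auto.
  + revert Hdom; apply filter_imp; intros v [_ Hv]; lra.
  + apply filter_forall; intros v; unfold n1, m1, w1; field.
  + eapply lim_eq; [repeat lim_step; lra|field].
Qed.

End Net.

(** * Equi-affine arclength and curvature of the envelope *)

Lemma near_interval (I : R -> Prop) (t0 r : R) :
  is_interval I -> I t0 -> 0 < r -> is_interval (near I t0 r).
Proof.
intros HI It0 Hr; split.
- intros a b x [Ia Ha] [Ib Hb] Hx; split; [apply (proj1 HI a b); auto|].
  apply Rabs_def2 in Ha; apply Rabs_def2 in Hb; apply Rabs_def1; lra.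
- destruct (punctured_proper I t0 HI It0) as [Hex _].
  destruct (Hex (fun v => near I t0 r v /\ v <> t0)) as (v & Hv & Hne).
  { exists (mkposreal r Hr); intros v Hv [Iv Hne].
    split; [split; [exact Iv|exact Hv]|exact Hne]. }
  assert (Hc : near I t0 r t0) by (split; [|rewrite Rminus_diag, Rabs_R0]; auto).
  destruct (Rdichotomy _ _ Hne); [exists v, t0|exists t0, v]; auto.
Qed.

Lemma Derive_n_on_step (D : R -> Prop) (f g g' : R -> R) (n : nat) :
  is_interval D ->
  (forall x, D x -> Derive_n_on D f n x = g x) ->
  (forall x, D x -> is_derive_on D g x (g' x)) ->
  forall x, D x -> Derive_n_on D f (S n) x = g' x.
Proof.
intros HD E Hg x Dx; apply Derive_on_unique; auto.
apply is_derive_on_ext with g; auto; intros y Dy; symmetry; auto.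
Qed.

Section Arclength.
Variables (D : R -> Prop) (HD : is_interval D).
Variables (j : nat -> R -> R) (Hj : jet D j).
Variable Hj2 : forall t, D t -> j 2%nat t <> 0.

Let j0 u (Du : D u) : is_derive_on D (j 0%nat) u (j 1%nat u) := Hj 0%nat u Du.
Let j1 u (Du : D u) : is_derive_on D (j 1%nat) u (j 2%nat u) := Hj 1%nat u Du.
Let j2 u (Du : D u) : is_derive_on D (j 2%nat) u (j 3%nat u) := Hj 2%nat u Du.
Let j3 u (Du : D u) : is_derive_on D (j 3%nat) u (j 4%nat u) := Hj 3%nat u Du.

(** Convertible to [envelope I h] when [j] is [Derive_n_on I h]. *)
Definition jet_envelope (t : R) : R * R :=
  (- j 1%nat t, j 0%nat t - t * j 1%nat t).

Lemma det_jet_envelope (t : R) :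
  D t ->
  det2 (curve_derive_n D jet_envelope 1 t) (curve_derive_n D jet_envelope 2 t)
  = j 2%nat t ^ 2.
Proof.
intros Dt.
assert (X1 : forall s, D s ->
  Derive_n_on D (fun s => fst (jet_envelope s)) 1 s = - j 2%nat s).
{ apply Derive_n_on_step with (fun s => - j 1%nat s); auto.
  intros s Ds; apply is_derive_on_opp; auto. }
assert (Y1 : forall s, D s ->
  Derive_n_on D (fun s => snd (jet_envelope s)) 1 s = - (s * j 2%nat s)).
{ apply Derive_n_on_step with (fun s => j 0%nat s - s * j 1%nat s); auto.
  intros s Ds; pose proof (j0 s Ds); pose proof (j1 s Ds).
  eapply is_derive_on_eq; [derive_on|simpl; ring]. }
assert (X2 : Derive_n_on D (fun s => fst (jet_envelope s)) 2 t = - j 3%nat t).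
{ apply (Derive_n_on_step D _ _ (fun s => - j 3%nat s) 1%nat HD X1); auto.
  intros s Ds; apply is_derive_on_opp; auto. }
assert (Y2 : Derive_n_on D (fun s => snd (jet_envelope s)) 2 t
             = - (j 2%nat t + t * j 3%nat t)).
{ apply (Derive_n_on_step D _ _ (fun s => - (j 2%nat s + s * j 3%nat s)) 1%nat HD Y1);
    auto.
  intros s Ds; pose proof (j2 s Ds).
  eapply is_derive_on_eq; [derive_on|simpl; ring]. }
unfold det2, curve_derive_n.
rewrite X1, X2, Y1, Y2 by exact Dt; simpl; ring.
Qed.

Definition affine_speed (t : R) : R := Rpower (Rabs (j 2%nat t ^ 2)) (1 / 3).

Lemma affine_speed_pos (t : R) : 0 < affine_speed t.
Proof. apply exp_pos. Qed.

Lemma affine_speed_deriv (t : R) :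
  D t -> is_derive_on D affine_speed t
           (2 / 3 * (j 3%nat t / j 2%nat t) * affine_speed t).
Proof.
intros Dt; pose proof (j2 t Dt); pose proof (Hj2 t Dt).
unfold affine_speed, Rpower.
eapply is_derive_on_eq.
- apply (is_derive_on_comp_real D t Dt exp).
  + derive_on; apply pow_nonzero; assumption.
  + apply is_derive_exp.
- simpl; field; assumption.
Qed.

Variable sigma : R -> R.
Hypothesis Hsigma : forall t, D t -> is_derive_on D sigma t (affine_speed t).

(** The constant [8/9] is [2/3 + 2/9]: the first part comes from differentiating
    [h''' / h''], the second from the square of [sigma'' / sigma']. *)
Lemma schwarzian_arclength (t : R) :
  D t ->
  schwarzian D sigma t
  = 2 / 3 * (j 4%nat t / j 2%nat t) - 8 / 9 * (j 3%nat t / j 2%nat t) ^ 2.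
Proof.
intros Dt.
assert (S1 : forall s, D s -> Derive_n_on D sigma 1 s = affine_speed s).
{ apply Derive_n_on_step with sigma; auto. }
assert (S2 : forall s, D s -> Derive_n_on D sigma 2 s
               = 2 / 3 * (j 3%nat s / j 2%nat s) * affine_speed s).
{ apply (Derive_n_on_step D _ affine_speed); auto using affine_speed_deriv. }
assert (Q : forall s, D s -> Derive_n_on D sigma 2 s / Derive_n_on D sigma 1 s
              = 2 / 3 * (j 3%nat s / j 2%nat s)).
{ intros s Ds; rewrite S1, S2 by exact Ds.
  pose proof (affine_speed_pos s); pose proof (Hj2 s Ds); field; split; lra. }
unfold schwarzian; rewrite Q by exact Dt.
rewrite (Derive_on_unique D _ t
  (2 / 3 * ((j 4%nat t * j 2%nat t - j 3%nat t * j 3%nat t) / j 2%nat t ^ 2))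
  HD Dt).
- pose proof (Hj2 t Dt); field; assumption.
- apply is_derive_on_ext with (fun s => 2 / 3 * (j 3%nat s / j 2%nat s)); auto.
  + intros s Ds; symmetry; auto.
  + pose proof (j2 t Dt); pose proof (j3 t Dt); pose proof (Hj2 t Dt).
    eapply is_derive_on_eq; [derive_on; lra|simpl; field; assumption].
Qed.

Variable tau : R -> R.
Hypothesis Htau : forall t, D t -> tau (sigma t) = t.

(** On the image of [sigma] the operator [d / ds] is [(1 / sigma') d / dt]; the
    image is an interval because [sigma] is increasing. *)
Lemma reparametrized_step (f g g' : R -> R) (n : nat) :
  (forall t, D t -> Derive_n_on (image sigma D) f n (sigma t) = g t) ->
  (forall t, D t -> is_derive_on D g t (g' t)) ->
  forall t, D t ->
    Derive_n_on (image sigma D) f (S n) (sigma t) = g' t / affine_speed t.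
Proof.
intros E Hg t Dt.
assert (Hpos : forall x, D x -> 0 < affine_speed x)
  by (intros x _; apply affine_speed_pos).
assert (HE : is_interval (image sigma D))
  by (apply image_interval with affine_speed; auto).
assert (Et : image sigma D (sigma t)) by (exists t; auto).
apply Derive_on_unique; auto.
apply is_derive_on_ext with (fun s => g (tau s)); auto.
- intros s (z & Dz & <-); rewrite Htau, E; auto.
- apply (is_derive_on_comp D); auto.
  + intros s (z & Dz & <-); rewrite Htau; auto.
  + rewrite Htau; auto.
  + apply (is_derive_on_inverse D sigma affine_speed); auto.
Qed.

(** The velocity is [- h'' / sigma' (1, t)].  In the second coordinate of the
    third derivative the terms in which [t] itself is differentiated cancel, since
    [sigma'' / sigma' = 2 h''' / (3 h'')]; hence the third derivative is again a
    multiple [Z / sigma'] of [(1, t)], and comparing the factors gives the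
    curvature. *)
Lemma affine_curvature_envelope (t : R) :
  D t ->
  affine_curvature (image sigma D) (fun s => jet_envelope (tau s)) (sigma t)
  = - (1 / 3 * (j 4%nat t / j 2%nat t) - 4 / 9 * (j 3%nat t / j 2%nat t) ^ 2)
    / affine_speed t ^ 2.
Proof.
intros Dt.
set (X := fun s => fst (jet_envelope (tau s))).
set (Y := fun s => snd (jet_envelope (tau s))).
set (E := image sigma D).
set (g := affine_speed).
assert (Hg : forall s, D s -> g s <> 0).
{ intros s _; pose proof (affine_speed_pos s); unfold g; lra. }
assert (X1 : forall s, D s -> Derive_n_on E X 1 (sigma s) = - j 2%nat s / g s).
{ apply (reparametrized_step X (fun s => - j 1%nat s) (fun s => - j 2%nat s) 0%nat).
  - intros s Ds; simpl; unfold X; rewrite Htau; auto.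
  - intros s Ds; apply is_derive_on_opp; auto. }
assert (Y1 : forall s, D s -> Derive_n_on E Y 1 (sigma s) = - (s * j 2%nat s) / g s).
{ apply (reparametrized_step Y (fun s => j 0%nat s - s * j 1%nat s)
           (fun s => - (s * j 2%nat s)) 0%nat).
  - intros s Ds; simpl; unfold Y; rewrite Htau; auto.
  - intros s Ds; pose proof (j0 s Ds); pose proof (j1 s Ds).
    eapply is_derive_on_eq; [derive_on|simpl; ring]. }
assert (X2 : forall s, D s ->
  Derive_n_on E X 2 (sigma s) = - (j 3%nat s / g s / 3) / g s).
{ apply (reparametrized_step X _ (fun s => - (j 3%nat s / g s / 3)) 1%nat X1).
  intros s Ds; pose proof (j2 s Ds); pose proof (affine_speed_deriv s Ds).
  pose proof (Hj2 s Ds); pose proof (Hg s Ds); unfold g in *.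
  eapply is_derive_on_eq; [derive_on; assumption|simpl; field; split; assumption]. }
assert (Y2 : forall s, D s ->
  Derive_n_on E Y 2 (sigma s) = - (j 2%nat s / g s + s * (j 3%nat s / g s / 3)) / g s).
{ apply (reparametrized_step Y _
           (fun s => - (j 2%nat s / g s + s * (j 3%nat s / g s / 3))) 1%nat Y1).
  intros s Ds; pose proof (j2 s Ds); pose proof (affine_speed_deriv s Ds).
  pose proof (Hj2 s Ds); pose proof (Hg s Ds); unfold g in *.
  eapply is_derive_on_eq; [derive_on; assumption|simpl; field; split; assumption]. }
set (Z := fun s => - (j 4%nat s - 4 / 3 * j 3%nat s ^ 2 / j 2%nat s) / (3 * g s ^ 2)).
assert (X3 : Derive_n_on E X 3 (sigma t) = Z t / g t).
{ apply (reparametrized_step X _ Z 2%nat X2); auto.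
  intros s Ds; pose proof (j3 s Ds); pose proof (affine_speed_deriv s Ds).
  pose proof (Hj2 s Ds); pose proof (Hg s Ds); unfold Z, g in *.
  eapply is_derive_on_eq; [derive_on; try assumption; lra
    |simpl; field; split; assumption]. }
assert (Y3 : Derive_n_on E Y 3 (sigma t) = t * Z t / g t).
{ apply (reparametrized_step Y _ (fun s => s * Z s) 2%nat Y2); auto.
  intros s Ds; pose proof (j2 s Ds); pose proof (j3 s Ds).
  pose proof (affine_speed_deriv s Ds).
  pose proof (Hj2 s Ds); pose proof (Hg s Ds); unfold Z, g in *.
  eapply is_derive_on_eq; [derive_on; try assumption; lra
    |simpl; field; split; assumption]. }
pose proof (Hj2 t Dt); pose proof (Hg t Dt).
unfold affine_curvature, curve_derive_n.
change (fun s => fst (jet_envelope (tau s))) with X.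
change (fun s => snd (jet_envelope (tau s))) with Y.
fold E; rewrite X1, Y1, X3, Y3 by exact Dt.
apply (@iota_unique R_AbsRing R_CompleteNormedModule).
- intros k Hk.
  change ((Z t / g t + k * (- j 2%nat t / g t),
           t * Z t / g t + k * (- (t * j 2%nat t) / g t)) = (0, 0)) in Hk.
  injection Hk as Hk _.
  apply (Rmult_eq_reg_r (- j 2%nat t / g t)).
  + replace (k * (- j 2%nat t / g t)) with (- (Z t / g t)) by lra.
    unfold Z, g in *; field; split; assumption.
  + intros E0; apply (Hj2 t Dt).
    replace (j 2%nat t) with (- (- j 2%nat t / g t * g t)) by (field; assumption).
    rewrite E0; ring.
- match goal with |- plus _ (scal ?k _) = _ =>
    change ((Z t / g t + k * (- j 2%nat t / g t),
           t * Z t / g t + k * (- (t * j 2%nat t) / g t)) = (0, 0)) end.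
  unfold Z, g in *; f_equal; field; split; assumption.
Qed.

End Arclength.

(** The restriction of the extension to a vertical slice of the square is
    continuous at the diagonal point, which determines the diagonal value from the
    values off the diagonal. *)
Lemma smooth_on_square_section (D : R -> Prop) (f : R -> R -> R) (t : R) :
  D t -> smooth_on_square D f ->
  filterlim (f t) (within D (locally t)) (locally (f t t)).
Proof.
intros Dt Hf.
apply (filterlim_comp _ _ _ (fun v => (t, v)) (fun p => f (fst p) (snd p)) _
         (within (square D) (locally (t, t)))).
- intros P [d Hd]; exists d; intros v Hv Dv.
  apply Hd; [split; [apply ball_center|exact Hv]|split; assumption].
- apply (proj1 (Hf 0%nat) (t, t)); split; exact Dt.
Qed.

(** * The diagonal value of the extension *)

Theorem theorem1p2
  (I : R -> Prop) (HI : is_interval I)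
  (h : R -> R) (Hh : smooth_on I h)
  (t0 : R) (Ht0 : I t0) (Hh2 : Derive_n_on I h 2 t0 <> 0)
  (Rh : R -> R -> R) (HRh : is_smooth_extension I h t0 Rh)
  (rho : R) (Hrho : 0 < rho)
  (Hrho2 : forall t, near I t0 rho t -> Derive_n_on I h 2 t <> 0)
  (sigma : R -> R)
  (Hsigma : is_affine_arclength (near I t0 rho) (envelope I h) sigma)
  (tau : R -> R) (Htau : forall t, near I t0 rho t -> tau (sigma t) = t) :
  within I (locally t0) (fun t =>
    Rh t t = 1 / 2 * schwarzian (near I t0 rho) sigma t /\
    Rh t t =
      - affine_curvature (image sigma (near I t0 rho))
          (fun s => envelope I h (tau s)) (sigma t)
      * Derive_on (near I t0 rho) sigma t ^ 2).
Proof.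
set (D := near I t0 rho) in *; set (j := Derive_n_on I h).
assert (HD : is_interval D) by (apply near_interval; assumption).
assert (HjI : jet I j) by (apply smooth_jet; assumption).
assert (HjD : jet D j).
{ intros k x Dx; apply is_derive_on_subset with I; [exact Dx| |].
  - intros y [Iy _]; exact Iy.
  - apply HjI, Dx. }
assert (Hs : forall t, D t -> is_derive_on D sigma t (affine_speed j t)).
{ intros t Dt; unfold affine_speed; rewrite <- (det_jet_envelope D HD j HjD t Dt).
  exact (Hsigma t Dt). }
destruct HRh as (r & Hr & Hsmooth & HR).
exists (mkposreal _ (Rmin_pos _ _ Hr Hrho)); intros t Ht It.
assert (Dr : near I t0 r t).
{ split; [exact It|]. eapply Rlt_le_trans; [exact Ht|apply Rmin_l]. }
assert (Dt : D t).
{ split; [exact It|]. eapply Rlt_le_trans; [exact Ht|apply Rmin_r]. }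
assert (Hval : Rh t t = j 4%nat t / (3 * j 2%nat t)
                        - 4 / 9 * (j 3%nat t / j 2%nat t) ^ 2).
{ pose proof (near_interval I t0 r HI Ht0 Hr) as Hint.
  pose proof (punctured_proper _ t Hint Dr) as FF.
  apply (@filterlim_locally_unique _ R_AbsRing R_NormedModule
           (punctured (near I t0 r) t) _ (Rh t)).
  - intros P HP; apply within_punctured.
    exact (smooth_on_square_section _ _ t Dr Hsmooth P HP).
  - apply lim_ext with (fun v => S_h I h t v - 1 / (v - t) ^ 2).
    + generalize (punctured_domain (near I t0 r) t).
      apply filter_imp; intros v [Dv Hv]; symmetry; auto.
    + intros P HP.
      generalize (diagonal_limit I HI j HjI t It (Hrho2 t Dt) P HP).
      unfold filtermap, punctured, within; apply filter_imp.
      intros v Hv [[Iv _] Hvt]; apply Hv; auto. }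
pose proof (Hrho2 t Dt) as Hj2; fold j in Hj2.
split; rewrite Hval.
- rewrite (schwarzian_arclength D HD j HjD Hrho2 sigma Hs t Dt).
  field; exact Hj2.
- rewrite (Derive_on_unique D sigma t _ HD Dt (Hs t Dt)).
  change (envelope I h) with (jet_envelope j).
  rewrite (affine_curvature_envelope D HD j HjD Hrho2 sigma Hs tau Htau t Dt).
  pose proof (affine_speed_pos j t).
  field; split; [exact Hj2|lra].
Qed.
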